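(* Let $X$ be a first countable weakly Grothendieck space and let $A \subseteq C_p(X,[0,1])$. Then $A$ is relatively compact in $C_p(X)$ (i.e. the closure of $A$ in $C_p(X)$ is compact) if and only if $A$ satisfies the following double limit condition: for every sequence $\langle f_n : n<\omega\rangle$ in $A$, every sequence $\langle x_m : m<\omega\rangle$ in $X$, and all ultrafilters $\mathcal{U},\mathcal{V}$ on $\omega$ (i.e. $\mathcal{U},\mathcal{V}\in\beta\omega$), $$\lim_{n\to\mathcal{U}}\lim_{m\to\mathcal{V}} f_n(x_m)=\lim_{m\to\mathcal{V}}\lim_{n\to\mathcal{U}} f_n(x_m)$$ whenever the limit $\lim_{m\to\mathcal{V}} x_m$ exists in $X$.
   Context: $C_p(X)$ denotes the space of continuous real-valued functions on $X$ with the topology of pointwise convergence (the subspace topology from $\mathbb{R}^X$), and $C_p(X,[0,1])$ its subspace of continuous functions into $[0,1]$. A subset $B\subseteq C_p(X)$ is countably compact in $C_p(X)$ if every infinite subset of $B$ has a limit point in $C_p(X)$. A space $X$ is weakly Grothendieck if, for every $B\subseteq C_p(X)$ that is countably compact in $C_p(X)$, the closure of $B$ in $C_p(X)$ is compact. For an ultrafilter $\mathcal{U}$ on $\omega$ and a sequence $\langle y_n\rangle$ in a topological space, $\lim_{n\to\mathcal{U}} y_n=y$ means that for every neighbourhood $W$ of $y$, $\{n : y_n\in W\}\in\mathcal{U}$. *)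

(* Defs.v *)
From HB Require Import structures.
From mathcomp Require Import all_boot all_order all_algebra.
From mathcomp Require Import all_classical all_reals all_analysis.

Set Implicit Arguments.
Unset Strict Implicit.
Unset Printing Implicit Defensive.

Import Order.TTheory GRing.Theory Num.Theory.
Import numFieldNormedType.Exports.

Local Open Scope classical_set_scope.
Local Open Scope ring_scope.

(* C_p(X): the continuous real-valued functions on X, with the subspace
   topology inherited from R^X. *)
Definition Cp (R : realType) (X : topologicalType) : Type := continuousType X R.

Definition Cp_incl (R : realType) (X : topologicalType) (f : Cp R X) :
  {ptws X -> R} := (f : continuousType X R).

HB.instance Definition _ (R : realType) (X : topologicalType) :=
  Choice.copy (Cp R X) (continuousType X R).
HB.instance Definition _ (R : realType) (X : topologicalType) :=
  Topological.copy (Cp R X) (initial_topology (@Cp_incl R X)).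

Definition Cp01 (R : realType) (X : topologicalType) : set (Cp R X) :=
  [set f | forall x, 0 <= f x <= 1].

Definition first_countable (X : topologicalType) : Prop :=
  forall x : X, exists2 B : set (set X), countable B &
    B `<=` nbhs x /\ forall W, nbhs x W -> exists2 V, B V & V `<=` W.

(* Relative notion: the limit points may lie outside B. *)
Definition countably_compact_in (T : topologicalType) (B : set T) : Prop :=
  forall E : set T, E `<=` B -> infinite_set E -> limit_point E !=set0.

Definition weakly_Grothendieck (R : realType) (X : topologicalType) : Prop :=
  forall B : set (Cp R X), countably_compact_in B -> compact (closure B).

(* [lim] is total, with a default value when there is no limit. For A included
   in [Cp01] all the real limits below exist, by [ultralimit01]. *)
Definition double_limit_condition (R : realType) (X : topologicalType)
    (A : set (Cp R X)) : Prop :=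
  forall (f : nat -> Cp R X) (x : nat -> X) (U V : set_system nat),
    (forall n, A (f n)) -> UltraFilter U -> UltraFilter V ->
    (exists p : X, x m @[m --> V] --> p) ->
    lim ((lim (f n (x m) @[m --> V])) @[n --> U]) =
    lim ((lim (f n (x m) @[n --> U])) @[m --> V]).

Lemma ultralimit01 (R : realType) (a : nat -> R) (U : set_system nat) :
  UltraFilter U -> (forall n, 0 <= a n <= 1) ->
  cvg (a n @[n --> U]) /\ 0 <= lim (a n @[n --> U]) <= 1.
Proof.
move=> UU a01.
have [l [l01 al]] : `[(0:R), 1]%classic `&` cluster (a n @[n --> U]) !=set0.
  have aU : U (a @^-1` `[(0:R), 1]%classic).
    by apply: filterE => n; move: (a01 n); rewrite /= in_itv.
  exact: (@segment_compact R 0 1 _ _ aU).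
have cv : a n @[n --> U] --> l.
  move=> W Wl; case: (in_ultra_setVsetC (a @^-1` W) UU) => // UW.
  by have [y []] := al (~` W) W UW Wl.
rewrite (cvg_lim (@Rhausdorff R) cv); split; first exact: cv.
by move: l01; rewrite /= in_itv.
Qed.

(* Main.v *)
Require Import Defs.
From mathcomp Require Import all_boot all_order all_algebra.
From mathcomp Require Import all_classical all_reals all_analysis.
Set Implicit Arguments.
Unset Strict Implicit.
Unset Printing Implicit Defensive.

Import Order.TTheory GRing.Theory Num.Theory numFieldNormedType.Exports.
Local Open Scope classical_set_scope.

(* If the closure of A is compact, a sequence f_n in A converges pointwise along
   U to some continuous g, and if x_m tends to p along V then both iterated
   limits equal g p.  Conversely, A is countably compact in C_p(X): given
   distinct f_n in A and a free ultrafilter U, the pointwise limit g of f_n along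
   U is continuous. Otherwise first countability provides x_m -> p with g(x_m)
   outside some neighbourhood of g p, while for a free ultrafilter V the double
   limit condition says that g(x_m) tends to g p along V.  So g is in C_p(X), and
   it is a limit point of the f_n since U is free; the weak Grothendieck property
   then makes the closure of A compact. *)

Lemma infinite_set_injective_seq {T : Type} (E : set T) :
  infinite_set E -> exists2 u : nat -> T, injective u & forall n, E (u n).
Proof.
move=> /infiniteP /card_leP[f].
(* [f] maps between the subtypes of [[set: nat]] and [E], so [n] is packed before applying it. *)
pose i n : [set: nat] := SigSub (mem_set (I : [set: nat] n)).
exists (fun n => val (f (i n))) => [m n /val_inj|n]; last exact: set_valP.
by move=> /(@inj _ _ _ f); rewrite !in_setT => /(_ isT isT)/(congr1 val).
Qed.

(** With a base at [p] enumerated as [b], [x m] is chosen in the first [m.+1] sets, so the sequence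
    stays in [b i] from index [i] on. *)
Lemma not_continuous_first_countable {X Y : topologicalType} (f : X -> Y)
    (p : X) : first_countable X -> ~ {for p, continuous f} ->
  exists2 W, nbhs (f p) W &
    exists2 x : nat -> X, x m @[m --> \oo] --> p & forall m, ~ W (f (x m)).
Proof.
move=> /(_ p)[B countB [Bp Bbase]] /existsNP[W] /not_implyP[Wfp nfW].
exists W => //.
(* The base cannot be empty: one of its members lies inside [setT]. *)
have /pfcard_geP[B0|[b]] := countB.
  by have [V] := Bbase setT filterT; rewrite B0.
have Vp n : \forall y \near p, forall i : 'I_n.+1, b i y.
  by apply: filter_forall => i; apply: Bp; exact: funS.
have /choice[x xP] n : exists y, (forall i : 'I_n.+1, b i y) /\ ~ W (f y).
  apply: contrapT => nex; apply: nfW; apply: filterS (Vp n) => y by_ /=.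
  by apply: contrapT => nWy; apply: nex; exists y.
exists x => [V /Bbase[V' BV' V'V]|m]; last by have [] := xP m.
have [i _ biV'] : (b @` setT) V' by exact: surj.
exists i => // m /= im; apply: V'V; rewrite -biV'.
by have [/(_ (Ordinal (im : (i < m.+1)%N)))] := xP m.
Qed.

Lemma ultra_fmap {T S : Type} (f : T -> S) (F : set_system T) :
  UltraFilter F -> UltraFilter (f @ F).
Proof.
move=> FU; split=> [|G GF FG]; first exact: fmap_proper_filter.
rewrite eqEsubset; split=> // B GB.
have [//|FnB] := in_ultra_setVsetC (f @^-1` B) FU.
by have [y []] := filter_ex (filterI GB (FG (~` B) FnB)).
Qed.

Lemma exists_free_ultrafilter :
  exists2 U : set_system nat, UltraFilter U & \oo `<=` U.
Proof. by have [U []] := ultraFilterLemma eventually_filter; exists U. Qed.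

(** Open sets of [Cp R X] are the preimages under [Cp_incl] of open sets of the product, where
    convergence is pointwise. *)
Lemma cvg_CpP (R : realType) (X : topologicalType) (F : set_system (Cp R X))
    (f : Cp R X) : Filter F ->
  (F --> f) <-> (forall x, g x @[g --> F] --> f x).
Proof.
move=> FF.
have <- : (@Cp_incl R X g @[g --> F] --> Cp_incl f) <->
    (forall x, g x @[g --> F] --> f x) by exact: pointwise_cvgP.
split=> [Ff|Ff W].
  apply: cvg_trans; first exact: cvg_app Ff.
  exact: (@initial_continuous _ _ (@Cp_incl R X)).
move=> [_ [[V oV <-] Vf] VW].
by apply: filterS VW _; apply: Ff; exact: open_nbhs_nbhs.
Qed.

Lemma compact_double_limit (R : realType) (X : topologicalType)
    (A : set (Cp R X)) : compact (closure A) -> double_limit_condition A.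
Proof.
rewrite compact_ultra => cA f x U V Af UU VU [p xp].
have UfU := ultra_fmap f UU.
have [g [_ fg]] : closure A `&` [set g | f n @[n --> U] --> g] !=set0.
  apply: cA; apply: (@filterE _ U) => n; exact: (subset_closure (Af n)).
have {}fg y : f n y @[n --> U] --> g y by have /cvg_CpP := fg; exact.
have ev (h : Cp R X) : h (x m) @[m --> V] --> h p.
  by apply: cvg_comp xp _; exact: cts_fun.
under eq_fun do rewrite (cvg_lim (@Rhausdorff R) (ev _)).
under [in RHS]eq_fun do rewrite (cvg_lim (@Rhausdorff R) (fg _)).
by rewrite (cvg_lim (@Rhausdorff R) (fg _)) (cvg_lim (@Rhausdorff R) (ev _)).
Qed.

Lemma double_limit_ultralimit_continuous (R : realType) (X : topologicalType)
    (A : set (Cp R X)) (f : nat -> Cp R X) (U : set_system nat) :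
  first_countable X -> A `<=` @Cp01 R X -> double_limit_condition A ->
  (forall n, A (f n)) -> UltraFilter U ->
  continuous (fun x => lim (f n x @[n --> U]) : R).
Proof.
move=> X1 A01 dlA Af UU p; apply: contrapT.
move=> /(not_continuous_first_countable X1)[W Wp [x xp nWx]].
have [V VU ooV] := exists_free_ultrafilter.
have {}xp : x m @[m --> V] --> p by move=> N /xp; exact: ooV.
have fxp n : f n (x m) @[m --> V] --> f n p.
  by apply: cvg_comp xp _; exact: cts_fun.
(* As [lim] is total, the outer limit along [V] must be shown to exist; it does because the inner
   limits along [U] stay in the unit interval. *)
have [cvx _] := ultralimit01 VU
  (fun m => (ultralimit01 UU (fun n => A01 _ (Af n) (x m))).2).
have dl := dlA f x U V Af UU VU (ex_intro _ p xp).
have lim_fp : (fun n => lim (f n (x m) @[m --> V])) = (fun n => f n p).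
  by apply/funext => n; exact: (cvg_lim (@Rhausdorff R) (fxp n)).
rewrite lim_fp in dl; rewrite dl in Wp.
by have [m] := @filter_ex _ V _ _ (cvx W Wp); exact: nWx.
Qed.

Lemma double_limit_countably_compact (R : realType) (X : topologicalType)
    (A : set (Cp R X)) :
  first_countable X -> A `<=` @Cp01 R X -> double_limit_condition A ->
  countably_compact_in A.
Proof.
move=> X1 A01 dlA E EA /infinite_set_injective_seq[f injf Ef].
have [U UU ooU] := exists_free_ultrafilter.
have Af n : A (f n) by exact/EA/Ef.
have cg := double_limit_ultralimit_continuous X1 A01 dlA Af UU.
pose g : Cp R X := mkcts cg.
have fg : f n @[n --> U] --> g.
  by apply/cvg_CpP => x; exact: (ultralimit01 UU (fun n => A01 _ (Af n) x)).1.
exists g => W /fg UW.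
(* A limit point needs members of [E] other than [g]: by injectivity at most one [f k] equals [g],
   and the free [U] contains the tail beyond [k]. *)
have : U [set n | f n != g].
  have [[k /= fk]|nfk] := pselect (exists k, f k = g).
    apply: ooU; exists k.+1 => // n /= kn.
    by apply/eqP => fn; move: kn; rewrite (injf n k) ?ltnn// fn.
  by apply: filterE => n; apply/eqP => fn; apply: nfk; exists n.
by move=> /(@filterI _ U _ _ _ UW)/(@filter_ex _ U)[n [Wn ng]]; exists (f n).
Qed.

Theorem theorem6p1 (R : realType) (X : topologicalType)
  (X_first_countable : first_countable X)
  (X_weakly_Grothendieck : weakly_Grothendieck R X)
  (A : set (Cp R X)) (A_Cp01 : A `<=` @Cp01 R X) :
  compact (closure A) <-> double_limit_condition A.
Proof.
split; first exact: compact_double_limit.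
by move=> dlA; exact/X_weakly_Grothendieck/double_limit_countably_compact.
Qed.
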